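(* For every $n\ge 2$, $s_n^0(132,231,312)=\frac12\left(1+(-1)^n\right)$, and for every integer $k\ge 1$, $$s_n^{2k}(132,231,312)=\begin{cases}1+(-1)^n & \text{if } n>2k,\\ 1 & \text{if } n=2k,\end{cases}$$ and $$s_n^{2k-1}(132,231,312)=\begin{cases}1+(-1)^{n+1} & \text{if } n>2k-1,\\ 1 & \text{if } n=2k-1.\end{cases}$$
   Context: $S_n$ denotes the set of permutations of $\{1,\dots,n\}$ written in one-line notation $\pi=\pi_1\pi_2\cdots\pi_n$. For $\alpha\in S_m$, $\pi\in S_n$ contains the pattern $\alpha$ if there are indices $i_1<i_2<\dots<i_m$ such that $\pi_{i_1}\pi_{i_2}\cdots\pi_{i_m}$ is order-isomorphic to $\alpha$; otherwise $\pi$ avoids $\alpha$. For a set $T$ of patterns, $S_n^k(T)$ is the set of $\pi\in S_n$ that have exactly $k$ fixed points (indices $i$ with $\pi_i=i$) and avoid every pattern in $T$; $s_n^k(T)=|S_n^k(T)|$. The braces around $T$ are omitted, e.g. $s_n^k(132,231,312)=s_n^k(\{132,231,312\})$. *)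

(* Defs.v *)
From mathcomp Require Import all_boot all_fingroup.

Set Implicit Arguments.
Unset Strict Implicit.
Unset Printing Implicit Defensive.

(* Permutations of {1, ..., n} are represented by 'S_n, the permutations of
   'I_n = {0, ..., n-1}; positions and values are both shifted by one, which
   changes neither fixed points nor order-isomorphism. *)

(* w is the one-line notation of a permutation of {1, ..., size w}. *)
Definition is_word (w : seq nat) : bool := perm_eq w (iota 1 (size w)).

Lemma word_bounds (w : seq nat) (Hw : is_word w) (i : 'I_(size w)) :
  0 < nth 0 w i <= size w.
Proof.
have: nth 0 w i \in iota 1 (size w) by rewrite -(perm_mem Hw) mem_nth.
by rewrite mem_iota add1n ltnS.
Qed.

Lemma word_pred_lt (w : seq nat) (Hw : is_word w) (i : 'I_(size w)) :
  (nth 0 w i).-1 < size w.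
Proof. by case/andP: (word_bounds Hw i); case: (nth 0 w i). Qed.

Definition word_fun (w : seq nat) (Hw : is_word w) (i : 'I_(size w)) :
  'I_(size w) := Ordinal (word_pred_lt Hw i).

Lemma word_fun_inj (w : seq nat) (Hw : is_word w) : injective (word_fun Hw).
Proof.
move=> i j /(congr1 (fun k : 'I_(size w) => k.+1)) /=.
case/andP: (word_bounds Hw i) => i_gt0 _.
case/andP: (word_bounds Hw j) => j_gt0 _.
rewrite !prednK // => /eqP; rewrite nth_uniq ?ltn_ord //.
  by move/eqP/val_inj.
by rewrite (perm_uniq Hw) iota_uniq.
Qed.

Definition perm_of_word (w : seq nat) (Hw : is_word w) : 'S_(size w) :=
  perm (@word_fun_inj w Hw).

Lemma perm_of_wordE (w : seq nat) (Hw : is_word w) (i : 'I_(size w)) :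
  (perm_of_word Hw i).+1 = nth 0 w i.
Proof. by rewrite permE /= prednK //; case/andP: (word_bounds Hw i). Qed.

Definition contains (m n : nat) (a : 'S_m) (p : 'S_n) : bool :=
  [exists f : {ffun 'I_m -> 'I_n},
     [forall i : 'I_m, forall j : 'I_m, (i < j) ==> (f i < f j)] &&
     [forall i : 'I_m, forall j : 'I_m, (p (f i) < p (f j)) == (a i < a j)]].

Definition pattern : Type := {m : nat & 'S_m}.

Definition avoids (n : nat) (p : 'S_n) (T : seq pattern) : bool :=
  all (fun t : pattern => ~~ contains (tagged t) p) T.

Definition num_fixed (n : nat) (p : 'S_n) : nat := #|[set i | p i == i]|.

Definition avoid_set (n k : nat) (T : seq pattern) : {set 'S_n} :=
  [set p : 'S_n | (num_fixed p == k) && avoids p T].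

Definition num_avoid (n k : nat) (T : seq pattern) : nat := #|avoid_set n k T|.

Definition pattern_of_word (w : seq nat) (Hw : is_word w) : pattern :=
  Tagged (fun m => 'S_m) (perm_of_word Hw).

Definition p132 : pattern := @pattern_of_word [:: 1; 3; 2] erefl.
Definition p231 : pattern := @pattern_of_word [:: 2; 3; 1] erefl.
Definition p312 : pattern := @pattern_of_word [:: 3; 1; 2] erefl.

(* Main.v *)
Require Import Defs.
From mathcomp Require Import all_boot all_order all_fingroup all_algebra.
From mathcomp Require Import zify.
Import GRing.Theory Num.Theory.
Local Open Scope ring_scope.

(** A permutation avoiding 132, 231 and 312 is determined by the position [m]
    of its smallest value, [0] when positions and values start at [0].  Before
    [m] the entries decrease, since an ascent there followed by the minimum is
    a 231; after [m] they increase, since the minimum followed by a descent is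
    a 132; and every entry before [m] is smaller than every entry after [m],
    since otherwise these two entries around the minimum form a 312.  So the
    relative order of all entries is known, and the permutation is the one that
    reverses the block [0..m] and fixes every later point ([avoidsP]).  All
    these permutations do avoid the three patterns.

    The reversed block has length [m.+1]; it contains one fixed point, its
    middle, when [m] is even and none when [m] is odd.  The permutation thus has
    [n - m.+1 + ~~ odd m] fixed points ([num_fixed_rev_prefix]), and for given
    [k] only [m = n - k - 1] and [m = n - k] can give [k] fixed points; both do
    so exactly when [n - k] is even, subject to [0 <= m < n].  This gives the
    closed form [num_avoidE], of which the theorem is a case analysis. *)

Section Avoidance.

Local Open Scope nat_scope.
Set Implicit Arguments.
Unset Strict Implicit.

(** * Patterns of length three *)

(** Comparing each pair of positions in one direction is enough, because the
    entries of a permutation, and those of a word, are pairwise distinct. *)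
Lemma contains3P (a b c : nat) (Hw : is_word [:: a; b; c]) (n : nat)
    (p : 'S_n) :
  reflect (exists i j k : 'I_n, [/\ i < j, j < k,
             (p i < p j) = (a < b), (p i < p k) = (a < c)
             & (p j < p k) = (b < c)])
          (contains (perm_of_word Hw) p).
Proof.
have vE (i : 'I_3) : (perm_of_word Hw i).+1 = nth 0 [:: a; b; c] i.
  exact: perm_of_wordE.
have ltE (i j : 'I_3) : (perm_of_word Hw i < perm_of_word Hw j) =
    (nth 0 [:: a; b; c] i < nth 0 [:: a; b; c] j) by rewrite -!vE ltnS.
have : uniq [:: a; b; c] by rewrite (perm_uniq Hw) iota_uniq.
rewrite /= !inE !andbT => /andP[/norP[neq_ab neq_ac] neq_bc].
apply: (iffP existsP) => [[f /andP[/forallP f_mono /forallP f_iso]] | ].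
  pose o0 : 'I_3 := Ordinal (isT : 0 < 3).
  pose o1 : 'I_3 := Ordinal (isT : 1 < 3).
  pose o2 : 'I_3 := Ordinal (isT : 2 < 3).
  exists (f o0), (f o1), (f o2).
  split; first exact: (implyP (forallP (f_mono o0) o1)).
  - exact: (implyP (forallP (f_mono o1) o2)).
  - by rewrite (eqP (forallP (f_iso o0) o1)) ltE.
  - by rewrite (eqP (forallP (f_iso o0) o2)) ltE.
  - by rewrite (eqP (forallP (f_iso o1) o2)) ltE.
move=> [i [j [k [lt_ij lt_jk pij pik pjk]]]].
have neq_p (x y : 'I_n) : x < y -> (p x : nat) != p y.
  move=> lt_xy; apply: contraTneq lt_xy => /val_inj/perm_inj->.
  by rewrite ltnn.
have nij := neq_p _ _ lt_ij; have njk := neq_p _ _ lt_jk.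
have nik := neq_p _ _ (ltn_trans lt_ij lt_jk).
exists [ffun x : 'I_3 => nth k [:: i; j; k] x].
apply/andP; split; apply/forallP => x; apply/forallP => y; rewrite !ffunE.
  by case: x => [[|[|[|//]]] ?]; case: y => [[|[|[|//]]] ?] //=; lia.
rewrite ltE.
by case: x => [[|[|[|//]]] ?]; case: y => [[|[|[|//]]] ?] /=; lia.
Qed.

(** * The permutations that reverse a prefix *)

Lemma rev_prefix_lt (n : nat) (m i : 'I_n) : (if i <= m then m - i else i) < n.
Proof. by have := ltn_ord m; have := ltn_ord i; case: ifP; lia. Qed.

Definition rev_prefix_fun (n : nat) (m i : 'I_n) : 'I_n :=
  Ordinal (rev_prefix_lt m i).

Lemma rev_prefix_inj (n : nat) (m : 'I_n) : injective (@rev_prefix_fun n m).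
Proof.
by move=> i j /(congr1 val) /= eq_ij; apply: val_inj; move: eq_ij => /=;
  do !case: ifP; lia.
Qed.

Definition rev_prefix (n : nat) (m : 'I_n) : 'S_n := perm (@rev_prefix_inj n m).

Lemma rev_prefixE (n : nat) (m i : 'I_n) :
  rev_prefix m i = (if i <= m then m - i else i) :> nat.
Proof. by rewrite permE. Qed.

(** The parameter can be read off as the position of the value [0]. *)
Lemma rev_prefix_param_inj (n : nat) : injective (@rev_prefix n).
Proof.
move=> m1 m2 eq_rev; apply: val_inj => /=.
have := rev_prefixE m1 m1; have := rev_prefixE m1 m2.
by rewrite eq_rev !rev_prefixE; do !case: ifP; lia.
Qed.

Lemma sum_lt_nat (n a : nat) : \sum_(i < n) (i < a) = minn n a.
Proof.
elim: n => [|n IHn]; first by rewrite big_ord0 min0n.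
by rewrite big_ord_recr /= IHn; lia.
Qed.

(** A permutation is determined by the relative order of its entries: [p i] is
    the number of entries smaller than [p i]. *)
Lemma perm_eq_order (n : nat) (p q : 'S_n) :
  (forall i j, (p i < p j) = (q i < q j)) -> p = q.
Proof.
have rankE (s : 'S_n) (i : 'I_n) : \sum_(j < n) (s j < s i) = s i.
  transitivity (\sum_(x < n) (x < s i)); first by rewrite [RHS](reindex_perm s).
  by rewrite sum_lt_nat; apply/minn_idPr/ltnW.
move=> eq_lt; apply/permP => i; apply: val_inj; rewrite /= -rankE -[RHS]rankE.
by apply: eq_bigr => j _; rewrite eq_lt.
Qed.

(** The entries around the minimum are compared by the three pattern conditions,
    each applied to a triple that contains the position of the minimum; these
    comparisons are exactly those of [rev_prefix], so [perm_eq_order] concludes.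
    Conversely no triple of entries of [rev_prefix m] can form a 132 or a 231,
    as the entries fall and then rise, nor a 312, as the falling part lies
    below the rest. *)
Lemma avoidsP (n : nat) (p : 'S_n) : 0 < n ->
  reflect (exists m, p = rev_prefix m) (avoids p [:: p132; p231; p312]).
Proof.
move=> n_gt0; rewrite /avoids /= andbT.
apply: (iffP and3P)
  => [[/contains3P no132 /contains3P no231 /contains3P no312] | [m ->]].
  pose z : 'I_n := Ordinal n_gt0.
  pose m := (p^-1)%g z; have pm : p m = 0 :> nat by rewrite permKV.
  have p_inj (x y : 'I_n) : p x = p y :> nat -> x = y :> nat.
    by move=> /val_inj/perm_inj->.
  have pos (x : 'I_n) : x != m :> nat -> 0 < p x.
    by have := p_inj x m; lia.
  have dec (x y : 'I_n) : x < y <= m -> p y < p x.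
    move=> /andP[lt_xy le_ym]; rewrite ltnNge; apply/negP => le_p.
    have npxy := p_inj x y; have npxm := pos x.
    have neq_ym : y != m :> nat.
      by apply/eqP => eq_ym; move: le_p npxm; rewrite (val_inj eq_ym) pm; lia.
    by apply: no231; exists x, y, m; have := pos y neq_ym; split; lia.
  have inc (x y : 'I_n) : m <= x < y -> p x < p y.
    move=> /andP[le_mx lt_xy]; rewrite ltnNge; apply/negP => le_p.
    have npxy := p_inj x y; have npym := pos y.
    have neq_xm : x != m :> nat.
      by apply/eqP => eq_xm; move: le_p npym; rewrite (val_inj eq_xm) pm; lia.
    by apply: no132; exists m, x, y; have := pos x neq_xm; split; lia.
  have low (x y : 'I_n) : x < m < y -> p x < p y.
    move=> /andP[lt_xm lt_my]; rewrite ltnNge; apply/negP => le_p.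
    have npxy := p_inj x y; have npym := pos y; have npxm := pos x.
    by apply: no312; exists x, m, y; split; lia.
  exists m; apply: perm_eq_order => i j; rewrite !rev_prefixE.
  have [lt_ij | lt_ji | /val_inj->] := ltngtP i j; last by rewrite !ltnn.
    by have := dec i j; have := inc i j; have := low i j; do !case: ifP; lia.
  by have := dec j i; have := inc j i; have := low j i; do !case: ifP; lia.
by split; apply/contains3P => -[i [j [k []]]]; rewrite !rev_prefixE;
  do !case: ifP; lia.
Qed.

(** * Counting fixed points *)

Lemma sum_eq_nat (n a : nat) : \sum_(i < n) (i == a :> nat) = (a < n).
Proof.
elim: n => [|n IHn]; first by rewrite big_ord0.
by rewrite big_ord_recr /= IHn; lia.
Qed.

Lemma num_fixed_rev_prefix (n : nat) (m : 'I_n) :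
  num_fixed (rev_prefix m) = n - m.+1 + ~~ odd m.
Proof.
(* A point [i <= m] is fixed when [i + i = m], hence the term for [m./2]. *)
have -> : num_fixed (rev_prefix m) =
    \sum_(i < n) ((m < i) + ~~ odd m * (i == m./2 :> nat)).
  rewrite /num_fixed -sum1dep_card big_mkcond; apply: eq_bigr => i _.
  rewrite -val_eqE /= rev_prefixE; have := odd_double_half m.
  by case: (odd m); case: leqP; case: eqP; lia.
rewrite big_split -big_distrr /= sum_eq_nat.
have -> : \sum_(i < n) (m < i : nat) = n - m.+1.
  elim: n {m}(m : nat) => [|n IHn] m; first by rewrite big_ord0.
  by rewrite big_ord_recr /= IHn; lia.
by have := ltn_ord m; case: (odd m); lia.
Qed.

(** The summand [k < n] accounts for [m = n - k - 1], where the reversed block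
    has no fixed point of its own, and [0 < k] for [m = n - k], where the middle
    of the block supplies one of the [k] fixed points. *)
Lemma num_avoidE (n k : nat) : 0 < n ->
  num_avoid n k [:: p132; p231; p312] =
    ((k <= n) && ~~ odd (n - k)) * ((k < n) + (0 < k)).
Proof.
move=> n_gt0.
have -> : num_avoid n k [:: p132; p231; p312] =
    #|[set m : 'I_n | n - m.+1 + ~~ odd m == k]|.
  rewrite /num_avoid -(card_imset _ (@rev_prefix_param_inj n)).
  apply: eq_card => p; rewrite inE; apply/andP/imsetP => [[fix_p] | [m + ->]].
    move=> /(avoidsP _ n_gt0)[m def_p]; exists m => //.
    by rewrite inE -num_fixed_rev_prefix -def_p.
  rewrite inE -num_fixed_rev_prefix => fix_m; split=> //.
  by apply/(avoidsP _ n_gt0); exists m.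
rewrite -sum1dep_card big_mkcond /=.
(* For [k = n] the predecessor truncates to [0]; the factor [k < n] discards
   this spurious solution. *)
transitivity (((k <= n) && ~~ odd (n - k)) *
    \sum_(m < n) ((k < n) * (m == (n - k).-1 :> nat) + (m == n - k :> nat))).
  rewrite big_distrr; apply: eq_bigr => m _ /=; have := ltn_ord m.
  have := odd_double_half m; have := odd_double_half (n - k).
  case: (odd m); case: (odd (n - k)); case: (ltngtP k n);
    case: eqP => /=; lia.
rewrite big_split -big_distrr /= !sum_eq_nat.
by case: (odd (n - k)); case: (ltngtP k n) => /=; lia.
Qed.

End Avoidance.

Theorem theorem3p7 (n : nat) (hn : (2 <= n)%N) :
  (num_avoid n 0 [:: p132; p231; p312])%:R = 1 / 2 * (1 + (-1) ^+ n) :> rat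
  /\ forall k : nat, (1 <= k)%N ->
     (((2 * k < n)%N ->
         (num_avoid n (2 * k) [:: p132; p231; p312])%:R
           = 1 + (-1) ^+ n :> rat)
      /\ (n = (2 * k)%N ->
         num_avoid n (2 * k) [:: p132; p231; p312] = 1%N))
     /\
     (((2 * k - 1 < n)%N ->
         (num_avoid n (2 * k - 1) [:: p132; p231; p312])%:R
           = 1 + (-1) ^+ n.+1 :> rat)
      /\ (n = (2 * k - 1)%N ->
         num_avoid n (2 * k - 1) [:: p132; p231; p312] = 1%N)).
Proof.
have n_gt0 : (0 < n)%N by lia.
have sgnE (e : nat) : 1 + (-1) ^+ e = (2 * ~~ odd e)%:R :> rat.
  by rewrite -signr_odd; case: (odd e).
split=> [|k k_gt0].
  rewrite sgnE natrM mulrA divfK // mul1r num_avoidE //.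
  by congr _%:R; rewrite subn0; lia.
rewrite !sgnE !num_avoidE //.
split; split=> [lt_kn | eq_nk].
- congr _%:R; have -> : odd (n - 2 * k) = odd n.
    by rewrite oddB ?oddM ?addbF // ltnW.
  by case: (odd n); lia.
- by rewrite -eq_nk subnn leqnn ltnn; lia.
- congr _%:R; have -> : odd (n - (2 * k - 1)) = odd n.+1.
    by rewrite !oddB ?oddM ?addbT //; lia.
  by case: (odd n.+1); lia.
- by rewrite -eq_nk subnn leqnn ltnn; lia.
Qed.
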